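(* (Convolutional self-similarity of the Hahn measure.) Let $a_1,a_2,b_1,b_2>0$ and let $N\ge0$ be an integer. Then for all integers $0\le x\le N$, $$\sum_{z=0}^x\pi(x-z,N-z,a_1,b_1)\,\pi(z,N,a_2,a_1+b_1)=\pi(x,N,a_1+a_2,b_1);$$ for all integers $0\le x\le y$, $$\sum_{z=x}^y\pi(x,z,a_1,b_1)\,\pi(z,y,a_1+b_1,b_2)=\sum_{z=x}^y\pi(x,z,a_1+b_1,b_2)\,\pi(z,y,a_1,b_1)=\pi(x,y,a_1,b_1+b_2);$$ and for all integers $0\le y\le x\le N$, $$\sum_{z=y}^x\pi(x-z,N-z,a_1,b_1)\,\pi(z-y,N-y,a_2,a_1+b_1)=\sum_{z=y}^x\pi(x-z,N-z,a_2,a_1+b_1)\,\pi(z-y,N-y,a_1,b_1)=\pi(x-y,N-y,a_1+a_2,b_1).$$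
   Context: $(a)_n=a(a+1)\cdots(a+n-1)$. The Hahn measure with parameters $a,b>0$ is, for integers $0\le x\le M$, $\pi(x,M,a,b)=\binom Mx\frac{(a)_x(b)_{M-x}}{(a+b)_M}$. *)

(* Defs.v *)
From mathcomp Require Import all_boot all_order all_algebra.

Set Implicit Arguments.
Unset Strict Implicit.
Unset Printing Implicit Defensive.

Import Order.TTheory GRing.Theory Num.Theory.
Local Open Scope ring_scope.

(* The rising factorial (a)_n = a (a + 1) ... (a + n - 1), with (a)_0 = 1. *)
Definition pochhammer (R : realFieldType) (a : R) (n : nat) : R :=
  \prod_(i < n) (a + i%:R).

(* The weight pi(x, M, a, b), intended for x <= M and a, b > 0. When M < x the
   subtraction [M - x] truncates, but the binomial coefficient vanishes. *)
Definition hahn (R : realFieldType) (x M : nat) (a b : R) : R :=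
  'C(M, x)%:R *
    (pochhammer a x * pochhammer b (M - x) / pochhammer (a + b) M).

(* Main.v *)
Require Import Defs.
From mathcomp Require Import all_boot all_order all_algebra.
From mathcomp Require Import ring zify.

Set Implicit Arguments.
Unset Strict Implicit.
Unset Printing Implicit Defensive.

Import Order.TTheory GRing.Theory Num.Theory.
Local Open Scope ring_scope.

(** In every composite the intermediate Pochhammer symbols cancel. When the
    parameters of the two kernels match, what remains is the
    Chu-Vandermonde sum; for the composition in the opposite order it is the
    Pfaff-Saalschuetz sum, which itself follows from three applications of
    Chu-Vandermonde. The third family of identities (of which the first is
    the case [y = 0]) is the second one read through the symmetry
    [pi(x, M, a, b) = pi(M - x, M, b, a)]. *)

(** Multiplied by [k! (m - k)! (n - m)!], both sides become [n!]. It leaves a single binomial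
    coefficient depending on [m], as a Chu-Vandermonde sum over [m] requires. *)
Lemma mul_bin_trinomial (n m k : nat) : (k <= m)%N -> (m <= n)%N ->
  ('C(n, m) * 'C(m, k) = 'C(n, k) * 'C(n - k, m - k))%N.
Proof.
move=> le_km le_mn; have le_kn := leq_trans le_km le_mn.
have sub_mk : (m - k <= n - k)%N by lia.
have fact_gt : (0 < k`! * (m - k)`! * (n - m)`!)%N by rewrite !muln_gt0 !fact_gt0.
apply/eqP; rewrite -(eqn_pmul2r fact_gt); apply/eqP.
have nm := bin_fact le_mn; have mk := bin_fact le_km.
have nk := bin_fact le_kn; have := bin_fact sub_mk.
have -> : (n - k - (m - k) = n - m)%N by lia.
move=> nkmk; transitivity (n`!).
- by rewrite -nm -mk; ring.
- by rewrite -nk -nkmk; ring.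
Qed.

Lemma sum_nat_subl (V : nmodType) (F : nat -> V) (N x y : nat) :
  (y <= x)%N -> (x <= N)%N ->
  \sum_(y <= z < x.+1) F (N - z)%N = \sum_(N - x <= z < (N - y).+1) F z.
Proof.
move=> le_yx le_xN.
rewrite big_nat_rev /= -{1}[y]add0n big_addn -{1}[(N - x)%N]add0n big_addn.
have -> : ((N - y).+1 - (N - x) = x.+1 - y)%N by lia.
by apply: eq_big_nat => i /andP[_ lt_i]; congr F; lia.
Qed.

Section Pochhammer.
Variable R : realFieldType.
Implicit Types (a b c : R) (m n k : nat).

Lemma pochhammer0 a : pochhammer a 0 = 1.
Proof. by rewrite /pochhammer big_ord0. Qed.

Lemma pochhammerS a n : pochhammer a n.+1 = pochhammer a n * (a + n%:R).
Proof. by rewrite /pochhammer big_ord_recr. Qed.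

Lemma pochhammerD a m n :
  pochhammer a (m + n) = pochhammer a m * pochhammer (a + m%:R) n.
Proof.
elim: n => [|n IHn]; first by rewrite addn0 pochhammer0 mulr1.
by rewrite addnS !pochhammerS IHn natrD addrA mulrA.
Qed.

Lemma pochhammer_gt0 a n : 0 < a -> 0 < pochhammer a n.
Proof. by move=> a_gt0; apply: prodr_gt0 => i _; rewrite ltr_wpDr. Qed.

(** Induction on [n]: the new factor [a + b + n] splits as [(a + i) + (b + (n - i))], each part
    extending one of the two Pochhammer symbols, and Pascal's rule recombines the terms. *)
Lemma pochhammer_Vandermonde a b n :
  \sum_(0 <= i < n.+1) 'C(n, i)%:R * (pochhammer a i * pochhammer b (n - i))
  = pochhammer (a + b) n.
Proof.
elim: n => [|n IHn]; first by rewrite big_nat1 bin0 !pochhammer0 !mul1r.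
rewrite pochhammerS -IHn big_distrl /=.
pose F i := 'C(n, i)%:R * (pochhammer a i.+1 * pochhammer b (n - i)).
pose G i := 'C(n, i)%:R * (pochhammer a i * pochhammer b (n.+1 - i)).
have -> : \sum_(0 <= i < n.+1) 'C(n, i)%:R * (pochhammer a i * pochhammer b (n - i))
            * (a + b + n%:R) = \sum_(0 <= i < n.+1) (G i + F i).
  apply: eq_big_nat => i /andP[_ lt_in]; rewrite /F /G subSn // !pochhammerS.
  by rewrite natrB //; ring.
rewrite big_nat_recl // [RHS]big_split /= [X in _ = X + _]big_nat_recl // -addrA.
congr (_ + _); first by rewrite /G !bin0.
(* The shifted sum of [G] has one extra term, [G n.+1], which vanishes since ['C(n, n.+1)] is 0. *)
transitivity (\sum_(0 <= i < n.+1) (G i.+1 + F i)); last first.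
  rewrite big_split /= big_nat_recr //= {2}/G bin_small ?mul0r ?addr0 //.
by apply: eq_bigr => i _; rewrite /F /G subSS binS natrD mulrDl.
Qed.

Lemma pochhammer_Vandermonde_shift a b k n : (k <= n)%N ->
  \sum_(k <= i < n.+1)
     'C(n - k, i - k)%:R * (pochhammer a (i - k) * pochhammer b (n - i))
  = pochhammer (a + b) (n - k).
Proof.
move=> le_kn; rewrite -pochhammer_Vandermonde -{1}[k]add0n big_addn.
have -> : (n.+1 - k = (n - k).+1)%N by lia.
apply: eq_big_nat => i _; rewrite addnK.
by have -> : (n - (i + k) = n - k - i)%N by lia.
Qed.

(* Expand the last factor by Chu-Vandermonde and exchange the sums; both the
   inner and the outer sum are then Chu-Vandermonde sums again. *)
Lemma pochhammer_Saalschutz a b c n :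
  \sum_(0 <= k < n.+1) 'C(n, k)%:R * (pochhammer a k * pochhammer b k
     * pochhammer c (n - k) * pochhammer (a + b + c + k%:R) (n - k))
  = pochhammer (a + c) n * pochhammer (b + c) n.
Proof.
pose T k m := 'C(n, m)%:R * (pochhammer b m * pochhammer (a + c) (n - m))
  * ('C(m, k)%:R * (pochhammer a k * pochhammer c (n - k))).
transitivity (\sum_(0 <= k < n.+1) \sum_(0 <= m < n.+1 | (k <= m)%N) T k m).
  apply: eq_big_nat => k /andP[_]; rewrite ltnS => le_kn.
  have -> : a + b + c + k%:R = (b + k%:R) + (a + c) by ring.
  rewrite -pochhammer_Vandermonde_shift // !big_distrr /=.
  (* The bound [k <= m] becomes a filter, so that both ranges are fixed and the sums can be
     exchanged. *)
  rewrite (@big_nat_widenl _ _ _ k 0) //=.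
  rewrite [LHS]big_nat_cond [RHS]big_nat_cond.
  apply: eq_bigr => m /andP[/andP[_ le_mn] le_km]; rewrite /T.
  have := congr1 (fun i => i%:R : R) (mul_bin_trinomial le_km le_mn).
  rewrite !natrM => trinomial.
  rewrite -[X in pochhammer b X * _](subnKC le_km) pochhammerD.
  rewrite [RHS](_ : _ = ('C(n, m)%:R * 'C(m, k)%:R) * (pochhammer b k *
    pochhammer (b + k%:R) (m - k) * pochhammer (a + c) (n - m)
    * (pochhammer a k * pochhammer c (n - k)))); last by ring.
  by rewrite trinomial; ring.
rewrite (exchange_big_dep_nat xpredT) //= -(pochhammer_Vandermonde b c).
rewrite big_distrr /=.
apply: eq_big_nat => m /andP[_]; rewrite ltnS => le_mn.
(* Writing [n = (n - m) + m] splits off from [(a + c)_n] the factor [(a + c + n - m)_m], which is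
   the inner sum over [k] up to the factor [(c)_(n - m)]. *)
rewrite /T -big_distrr /= -[X in _ = pochhammer _ X * _](subnK le_mn).
rewrite pochhammerD -[a + c + _]addrA.
rewrite -(pochhammer_Vandermonde a (c + _)).
rewrite (@big_nat_widen _ _ _ 0 m.+1 n.+1) //=.
rewrite !big_distrr !big_distrl /=; apply: eq_bigr => k le_km.
have -> : (n - k = (n - m) + (m - k))%N by lia.
by rewrite pochhammerD; ring.
Qed.

Lemma hahn_sym a b x M : (x <= M)%N -> hahn x M a b = hahn (M - x) M b a.
Proof.
move=> le_xM; rewrite /hahn bin_sub // subKn // [b + a]addrC.
by rewrite [pochhammer a x * _]mulrC.
Qed.

(** The denominator [(a + b)_z] of the first kernel cancels a numerator factor of the second,
    leaving Chu-Vandermonde in [b] and [c]. *)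
Lemma hahn_comp a b c x y : 0 < a -> 0 < b -> (x <= y)%N ->
  \sum_(x <= z < y.+1) hahn x z a b * hahn z y (a + b) c = hahn x y a (b + c).
Proof.
move=> a_gt0 b_gt0 le_xy; rewrite /hahn addrA -pochhammer_Vandermonde_shift //.
rewrite big_distrr big_distrl big_distrr /=.
apply: eq_big_nat => z /andP[le_xz]; rewrite ltnS => le_zy.
have nz := lt0r_neq0 (pochhammer_gt0 z (addr_gt0 a_gt0 b_gt0)).
have := congr1 (fun i => i%:R : R) (mul_bin_trinomial le_xz le_zy).
rewrite !natrM => trinomial.
set D := (pochhammer (a + b + c) y)^-1.
transitivity ('C(y, z)%:R * 'C(z, x)%:R * (pochhammer a x
  * pochhammer b (z - x) * pochhammer c (y - z) * D)); first by field.
by rewrite trinomial; ring.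
Qed.

Lemma hahn_comp_swap a b c x y :
  0 < a -> 0 < b -> 0 < c -> (x <= y)%N ->
  \sum_(x <= z < y.+1) hahn x z (a + b) c * hahn z y a b = hahn x y a (b + c).
Proof.
move=> a_gt0 b_gt0 c_gt0 le_xy; have ab_gt0 := addr_gt0 a_gt0 b_gt0.
have nz_ab n : pochhammer (a + b) n != 0 by rewrite lt0r_neq0 ?pochhammer_gt0.
have nz_abc n : pochhammer (a + b + c) n != 0.
  by rewrite lt0r_neq0 ?pochhammer_gt0 ?addr_gt0.
(* [K] collects the factors free of [z] once [1 / (a + b + c)_z] is put over the common denominator
   [(a + b + c)_y]. With [z = k + x], the rest is the Saalschuetz summand with parameters [a + x],
   [c], [b] and length [y - x]. *)
pose K := 'C(y, x)%:R * (pochhammer a x * pochhammer (a + b) x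
  / (pochhammer (a + b) y * pochhammer (a + b + c) y)).
transitivity (K * (pochhammer (a + x%:R + b) (y - x) * pochhammer (c + b) (y - x))).
  rewrite -pochhammer_Saalschutz big_distrr /= -{1}[x]add0n big_addn subSn //.
  apply: eq_big_nat => k /andP[_]; rewrite ltnS => le_k.
  have le_x : (x <= k + x)%N by rewrite leq_addl.
  have le_y : (k + x <= y)%N by lia.
  have := congr1 (fun i => i%:R : R) (mul_bin_trinomial le_x le_y).
  rewrite !natrM addnK => trinomial.
  have Dy : pochhammer (a + b + c) y = pochhammer (a + b + c) (k + x)
      * pochhammer (a + x%:R + c + b + k%:R) (y - x - k).
    have -> : a + x%:R + c + b + k%:R = a + b + c + (k + x)%:R :> R.
      by rewrite natrD; ring.
    by rewrite -pochhammerD; congr pochhammer; lia.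
  have nz := nz_abc y; rewrite Dy mulf_eq0 negb_or in nz.
  case/andP: nz => nz1 nz2.
  have Da : pochhammer a (k + x) = pochhammer a x * pochhammer (a + x%:R) k.
    by rewrite addnC pochhammerD.
  rewrite /K /hahn Dy addnK Da.
  have -> : (y - (k + x) = y - x - k)%N by lia.
  transitivity ('C(y, k + x)%:R * 'C(k + x, x)%:R * (pochhammer a x
    * pochhammer (a + x%:R) k * pochhammer b (y - x - k) * pochhammer c k
    * pochhammer (a + b) x / (pochhammer (a + b) y
    * pochhammer (a + b + c) (k + x)))); first by field; rewrite nz_ab nz1.
  by rewrite trinomial; field; rewrite nz_ab nz1 nz2.
have ab_y : pochhammer (a + b) y
    = pochhammer (a + b) x * pochhammer (a + x%:R + b) (y - x).
  by rewrite addrAC -pochhammerD subnKC.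
have nz := nz_ab y; rewrite ab_y mulf_eq0 negb_or in nz.
case/andP: nz => nz1 nz2.
rewrite /K /hahn ab_y addrA [c + b]addrC; field.
by rewrite nz_abc nz1 nz2.
Qed.

End Pochhammer.

Theorem mainTheorem18 (R : realFieldType) (a1 a2 b1 b2 : R) (N : nat)
    (ha1 : 0 < a1) (ha2 : 0 < a2) (hb1 : 0 < b1) (hb2 : 0 < b2) :
  [/\ (forall x : nat, (x <= N)%N ->
         \sum_(0 <= z < x.+1)
            hahn (x - z) (N - z) a1 b1 * hahn z N a2 (a1 + b1)
         = hahn x N (a1 + a2) b1),
      (forall x y : nat, (x <= y)%N ->
         \sum_(x <= z < y.+1) hahn x z a1 b1 * hahn z y (a1 + b1) b2
         = \sum_(x <= z < y.+1) hahn x z (a1 + b1) b2 * hahn z y a1 b1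
         /\
         \sum_(x <= z < y.+1) hahn x z (a1 + b1) b2 * hahn z y a1 b1
         = hahn x y a1 (b1 + b2))
    & (forall x y : nat, (y <= x)%N -> (x <= N)%N ->
         \sum_(y <= z < x.+1)
            hahn (x - z) (N - z) a1 b1 * hahn (z - y) (N - y) a2 (a1 + b1)
         = \sum_(y <= z < x.+1)
            hahn (x - z) (N - z) a2 (a1 + b1) * hahn (z - y) (N - y) a1 b1
         /\
         \sum_(y <= z < x.+1)
            hahn (x - z) (N - z) a2 (a1 + b1) * hahn (z - y) (N - y) a1 b1
         = hahn (x - y) (N - y) (a1 + a2) b1)].
Proof.
(* Reflecting both kernels by [hahn_sym] and substituting [N - z] for [z] turns a sum of the third
   family into one of the second, from [N - x] to [N - y], with each parameter pair swapped. *)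
have mirror a b c d x y : (y <= x)%N -> (x <= N)%N ->
    \sum_(y <= z < x.+1) hahn (x - z) (N - z) a b * hahn (z - y) (N - y) c d
  = \sum_(N - x <= z < (N - y).+1) hahn (N - x) z b a * hahn z (N - y) d c.
  move=> le_yx le_xN; rewrite -sum_nat_subl //.
  apply: eq_big_nat => z /andP[le_yz]; rewrite ltnS => le_zx.
  rewrite hahn_sym; last lia.
  rewrite [hahn (z - y) _ _ _]hahn_sym; last lia.
  by congr (hahn _ _ _ _ * hahn _ _ _ _); lia.
have fst_order x y : (y <= x)%N -> (x <= N)%N ->
    \sum_(y <= z < x.+1)
       hahn (x - z) (N - z) a1 b1 * hahn (z - y) (N - y) a2 (a1 + b1)
  = hahn (x - y) (N - y) (a1 + a2) b1.
  move=> le_yx le_xN; rewrite mirror // [a1 + b1]addrC hahn_comp //; last lia.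
  by rewrite [RHS]hahn_sym; last lia; congr hahn; lia.
split=> [x le_xN|x y le_xy|x y le_yx le_xN].
- rewrite -[x in RHS]subn0 -[N in RHS]subn0 -fst_order //.
  by apply: eq_big_nat => z _; rewrite !subn0.
- by rewrite hahn_comp // hahn_comp_swap.
rewrite fst_order // mirror // [a1 + b1]addrC hahn_comp_swap //; last lia.
rewrite [hahn (x - y) _ _ _]hahn_sym; last lia.
by have -> : (N - y - (x - y) = N - x)%N by lia.
Qed.
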